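(* Let $A\in\mathbb{C}^{n\times n}$ be given by a Hartwig–Spindelböck decomposition and let $X$ be a minimal rank weak Drazin inverse of $A$. If $Y=A^{\dagger}AXAA^{\dagger}$, then the following statements hold: (1) $Y=0$ if and only if $A$ is nilpotent; (2) $Y=A$ if and only if $A^{\dagger}=A$; (3) $Y=A^{*}$ if and only if $A^{\dagger}=A^{*}$ and $\operatorname{ind}(A)=1$.
   Context: $A^{*}$ is the conjugate transpose of $A$, and $A^{\dagger}$ is the Moore–Penrose inverse of $A$: the unique $T$ with $ATA=A$, $TAT=T$, $(AT)^{*}=AT$, $(TA)^{*}=TA$. The index $\operatorname{ind}(A)$ is the smallest nonnegative integer $k$ such that $\operatorname{rank}(A^k)=\operatorname{rank}(A^{k+1})$. $A^{D}$ is the Drazin inverse of $A$: the unique $T$ with $TAT=T$, $AT=TA$, $A^{k+1}T=A^k$ where $k=\operatorname{ind}(A)$. A matrix $X\in\mathbb{C}^{n\times n}$ is a minimal rank weak Drazin inverse of $A$ if $XA^{k+1}=A^{k}$ for some $k\in\mathbb{N}$ and $\operatorname{rank}(X)=\operatorname{rank}(A^{D})$. For a fixed such $X$, $A^{\dagger}AXAA^{\dagger}$ is called the weak CMP inverse of $A$. Hartwig–Spindelböck decomposition: every $A\in\mathbb{C}^{n\times n}$ of rank $r$ can be written as $A=U\begin{bmatrix}\Sigma K&\Sigma L\\0&0\end{bmatrix}U^{*}$, where $U\in\mathbb{C}^{n\times n}$ is unitary, $\Sigma=\operatorname{diag}(\sigma_1I_{r_1},\ldots,\sigma_tI_{r_t})$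 is the diagonal matrix of singular values of $A$, $\sigma_1>\cdots>\sigma_t>0$, $r_1+\cdots+r_t=r$, and $K\in\mathbb{C}^{r\times r}$, $L\in\mathbb{C}^{r\times(n-r)}$ satisfy $KK^{*}+LL^{*}=I_r$.
   Formalization: As printed, (3) fails for unitary A such as the identity, where Y = A^* and A^† = A^* but ind(A) = 0; the formal statement proves (3) as printed for singular A, and for every A with ''ind(A) ≤ 1'' in place of ''ind(A) = 1''. *)

(* Defs.v *)
From HB Require Import structures.
From mathcomp Require Import all_boot all_order all_algebra.
From mathcomp Require Import complex.
From mathcomp Require Import boolp classical_sets reals.

Set Implicit Arguments.
Unset Strict Implicit.
Unset Printing Implicit Defensive.

Import Order.TTheory GRing.Theory Num.Theory Num.Def.
Local Open Scope ring_scope.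
Local Open Scope sesquilinear_scope.
Local Open Scope complex_scope.

Section MoorePenrose.
Variables (C : numClosedFieldType) (m n : nat).
Implicit Types (A : 'M[C]_(m, n)) (T : 'M[C]_(n, m)).

Definition is_mpinv A T : Prop :=
  [/\ A *m T *m A = A, T *m A *m T = T,
      (A *m T) ^t* = A *m T & (T *m A) ^t* = T *m A].

(* xget picks the element of a set if there is one; mpinvP and mpinv_unique
   show that here there is exactly one. *)
Definition mpinv A : 'M[C]_(n, m) := xget 0 [set T | is_mpinv A T].
End MoorePenrose.

Section ConjugateTranspose.
Variable C : numClosedFieldType.

Lemma adjmxM m n p (A : 'M[C]_(m, n)) (B : 'M_(n, p)) :
  (A *m B) ^t* = B ^t* *m A ^t*.
Proof. by rewrite trmx_mul map_mxM. Qed.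

Lemma mulmx_adj_eq0 n (v : 'rV[C]_n) : v *m v ^t* = 0 -> v = 0.
Proof.
move=> /matrixP /(_ 0 0); rewrite !mxE => /eqP.
rewrite psumr_eq0 => [|j _]; last by rewrite !mxE mul_conjC_ge0.
move=> /allP v0; apply/rowP => j; rewrite !mxE.
have := v0 j (mem_index_enum j); rewrite !mxE /= mul_conjC_eq0.
by move/eqP.
Qed.

Lemma gram_unit r n (G : 'M[C]_(r, n)) : row_free G -> G *m G ^t* \in unitmx.
Proof.
move=> freeG; rewrite -row_free_unit; apply: inj_row_free => v vG0.
have /mulmx_adj_eq0/eqP : (v *m G) *m (v *m G) ^t* = 0.
  by rewrite adjmxM mulmxA -(mulmxA v) vG0 mul0mx.
by rewrite mulmx_free_eq0 // => /eqP.
Qed.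
End ConjugateTranspose.

Section MoorePenroseTheory.
Variables (C : numClosedFieldType) (m n : nat).
Implicit Types (A : 'M[C]_(m, n)) (T : 'M[C]_(n, m)).

Lemma mpinv_exists A : exists T, is_mpinv A T.
Proof.
have [r [F [G [freeG fullF AE]]]] : exists r (F : 'M[C]_(m, r)) (G : 'M_(r, n)),
    [/\ row_free G, row_full F & A = F *m G].
  exists (\rank A), (col_base A), (row_base A).
  by rewrite row_base_free col_base_full mulmx_base.
have uG : G *m G ^t* \in unitmx by exact: gram_unit.
have uF : F ^t* *m F \in unitmx.
  have -> : F ^t* *m F = F ^t* *m (F ^t*) ^t* by rewrite trmxCK.
  apply: gram_unit; rewrite /row_free mxrank_map mxrank_tr.
  exact: fullF.
pose Gi := G ^t* *m invmx (G *m G ^t*).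
pose Fi := invmx (F ^t* *m F) *m F ^t*.
have GGi : G *m Gi = 1%:M by rewrite mulmxA mulmxV.
have FiF : Fi *m F = 1%:M by rewrite -mulmxA mulVmx.
have hinv (B : 'M[C]_r) : B ^t* = B -> (invmx B) ^t* = invmx B.
  by move=> BE; rewrite trmx_inv map_invmx BE.
have hF : (F *m Fi) ^t* = F *m Fi.
  rewrite /Fi mulmxA !adjmxM trmxCK hinv ?mulmxA //.
  by rewrite adjmxM trmxCK.
have hG : (Gi *m G) ^t* = Gi *m G.
  rewrite /Gi !adjmxM trmxCK hinv ?mulmxA //.
  by rewrite adjmxM trmxCK.
have AT : A *m (Gi *m Fi) = F *m Fi.
  by rewrite AE mulmxA -(mulmxA F) GGi mulmx1.
have TA : Gi *m Fi *m A = Gi *m G.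
  by rewrite AE mulmxA -(mulmxA Gi) FiF mulmx1.
exists (Gi *m Fi); split; rewrite ?AT ?TA //.
- by rewrite {1}AE mulmxA -(mulmxA F) FiF mulmx1 -AE.
- by rewrite mulmxA -(mulmxA Gi) GGi mulmx1.
Qed.

Lemma is_mpinv_inj A T T' : is_mpinv A T -> is_mpinv A T' -> T = T'.
Proof.
move=> [a1 a2 a3 a4] [b1 b2 b3 b4].
have eA : A *m T = A *m T'.
  by rewrite -a3 -{1}b1 -mulmxA adjmxM b3 a3 mulmxA a1.
have eA' : T *m A = T' *m A.
  rewrite -a4 -{1}b1 -(mulmxA A) mulmxA adjmxM b4 a4 -mulmxA.
  by rewrite (mulmxA A) a1.
by rewrite -a2 eA' -mulmxA eA mulmxA b2.
Qed.

Lemma mpinvP A : is_mpinv A (mpinv A).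
Proof. exact: xgetPex (mpinv_exists A). Qed.

Lemma mpinv_unique A T : is_mpinv A T -> mpinv A = T.
Proof. by apply: is_mpinv_inj; exact: mpinvP. Qed.
End MoorePenroseTheory.

Section Drazin.
Variables (C : numClosedFieldType) (n : nat).
Implicit Types A T X : 'M[C]_n.

Lemma mxind_exists A : exists k : nat, \rank (A ^+ k) == \rank (A ^+ k.+1).
Proof.
apply: contrapT => /forallNP noind.
have rank_dec k : (\rank (A ^+ k) + k <= n)%N.
  elim: k => [|k IHk]; first by rewrite addn0 rank_leq_row.
  rewrite addnS -addSn (leq_trans _ IHk) // leq_add2r ltn_neqAle.
  rewrite eq_sym; apply/andP; split; first by apply/negP; exact: noind.
  by rewrite exprS; exact: mxrankM_maxr.
by have := rank_dec n.+1; rewrite addnS ltnNge leq_addl.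
Qed.

Definition mxind A : nat := ex_minn (mxind_exists A).

Definition is_drazin A T : Prop :=
  [/\ T *m A *m T = T, A *m T = T *m A &
      A ^+ (mxind A).+1 *m T = A ^+ mxind A].

(* Well defined by drazinP and drazin_unique. *)
Definition drazin A : 'M[C]_n := xget 0 [set T | is_drazin A T].

Definition is_minrank_weak_drazin A X : Prop :=
  (exists k : nat, X *m A ^+ k.+1 = A ^+ k) /\ \rank X = \rank (drazin A).

Lemma trmx_exp A k : (A ^+ k)^T = A^T ^+ k.
Proof.
elim: k => [|k IHk]; first by rewrite !expr0 trmx1.
by rewrite exprS exprSr trmx_mul IHk.
Qed.

Lemma mxrank_expS_factor A k j :
  \rank (A ^+ k) = \rank (A ^+ k.+1) -> exists P, A ^+ k = P *m A ^+ (k + j).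
Proof.
move=> rk; suff /submxP : (A ^+ k <= A ^+ (k + j))%MS by [].
have sub1 : (A ^+ k <= A ^+ k.+1)%MS.
  have /mxrank_leqif_sup[_ <-] : (A ^+ k.+1 <= A ^+ k)%MS.
    by rewrite exprS; exact: submxMl.
  by rewrite rk.
elim: j => [|j IHj]; first by rewrite addn0.
apply: (submx_trans IHj); have -> : (k + j.+1 = k.+1 + j)%N by rewrite addSnnS.
by rewrite !exprD; exact: submxMr.
Qed.

Lemma drazin_exists A : exists T, is_drazin A T.
Proof.
rewrite /is_drazin /mxind; case: ex_minnP => k /eqP rk _.
have [P PE] := mxrank_expS_factor k.+1 rk.
have [Q QE] : exists Q, A ^+ k = A ^+ (k + k.+1) *m Q.
  have rkT : \rank (A^T ^+ k) = \rank (A^T ^+ k.+1).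
    by rewrite -!trmx_exp !mxrank_tr.
  have [Q QE] := mxrank_expS_factor k.+1 rkT.
  by exists Q^T; rewrite -[LHS]trmxK trmx_exp QE trmx_mul -trmx_exp trmxK.
have TE : A ^+ k *m Q = P *m A ^+ k by rewrite {1}PE -mulmxA -QE.
have AT : A ^+ k.+1 *m (A ^+ k *m Q) = A ^+ k.
  by rewrite mulmxA -[_ *m A ^+ k]exprD addSnnS (addnC k) addSnnS -QE.
exists (A ^+ k *m Q); split => //.
- rewrite {1}TE -(mulmxA P); have -> : A ^+ k *m A = A ^+ k.+1 by rewrite exprSr.
  by rewrite -mulmxA AT TE.
- have -> : A *m (A ^+ k *m Q) = A ^+ k.+1 *m Q by rewrite exprS mulmxA.
  have -> : A ^+ k *m Q *m A = P *m A ^+ k.+1 by rewrite TE -mulmxA exprSr.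
  have comm : A *m A ^+ (k + k.+1) = A ^+ (k + k.+1) *m A.
    by rewrite -[LHS]exprS -[RHS]exprSr.
  have -> : P *m A ^+ k.+1 = P *m A ^+ (k + k.+1) *m (A *m Q).
    have -> : A ^+ k.+1 = A *m A ^+ k by rewrite exprS.
    by rewrite {1}QE !mulmxA -(mulmxA P A) comm mulmxA.
  by rewrite -PE mulmxA exprSr.
Qed.

Lemma is_drazin_inj A T T' : is_drazin A T -> is_drazin A T' -> T = T'.
Proof.
set k := mxind A.
have expT S : is_drazin A S -> forall j, S = A ^+ j * S ^+ j.+1.
  move=> [s1 s2 _]; elim=> [|j IHj]; first by rewrite expr0 mul1r.
  rewrite {1}IHj [A ^+ j.+1]exprSr [S ^+ j.+2]exprS -!mulrA; congr (_ * _).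
  rewrite mulrA [S ^+ j.+1 in RHS]exprS mulrA.
  have -> : A * S * S = S by rewrite [A * S]s2; exact: s1.
  by rewrite -exprS.
have expT' S : is_drazin A S -> forall j, S = S ^+ j.+1 * A ^+ j.
  move=> hS j; rewrite {1}(expT _ hS j); case: hS => [_ s2 _].
  have cAS : GRing.comm A S := s2.
  exact: (commrX _ (commr_sym (commrX _ (commr_sym cAS)))).
move=> hT hT'.
have [_ a2 a3] := hT; have [_ b2 b3] := hT'.
have TA : T *m A ^+ k.+1 = A ^+ k.
  have cAT : GRing.comm A T := a2.
  by rewrite -[RHS]a3; exact: (commrX _ (commr_sym cAT)).
have b3' : A ^+ k.+1 * T' = A ^+ k := b3.
have TA' : T * A ^+ k.+1 = A ^+ k := TA.
have e1 : T = T * A * T'.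
  have TE := expT' _ hT k.
  rewrite [in RHS]TE -(mulrA _ _ A) -exprSr -mulrA b3'.
  exact: TE.
have e2 : T' = T * A * T'.
  have TE := expT _ hT' k.
  rewrite [in RHS]TE mulrA -(mulrA T) -exprS TA'.
  exact: TE.
by rewrite e1 -e2.
Qed.

Lemma drazinP A : is_drazin A (drazin A).
Proof. exact: xgetPex (drazin_exists A). Qed.

Lemma drazin_unique A T : is_drazin A T -> drazin A = T.
Proof. by apply: is_drazin_inj; exact: drazinP. Qed.
End Drazin.

(* The Hartwig-Spindelbock decomposition
     A = U [Sigma K, Sigma L; 0, 0] U^*,  Sigma = diag (sigma_i I_(rs i)),
   of a matrix of rank r = \sum_i rs i and size r + m.  The sigma_i are
   required to be decreasing and positive; that they are the nonzero singular
   values of A, with multiplicities rs i, follows from the equations, since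
   A A^* = U [Sigma^2, 0; 0, 0] U^*. *)
Definition hartwig_spindelbock (R : realType) (t m : nat) (rs : 'I_t -> nat)
    (sigma : 'I_t -> R)
    (A U : 'M[R[i]]_(\sum_(i < t) rs i + m))
    (K : 'M[R[i]]_(\sum_(i < t) rs i))
    (L : 'M[R[i]]_(\sum_(i < t) rs i, m)) : Prop :=
  let Sigma := \mxdiag_(i < t) ((sigma i)%:C%:M : 'M[R[i]]_(rs i)) in
  [/\ (forall i, (0 < rs i)%N) /\ (forall i, 0 < sigma i),
      forall i j : 'I_t, (i < j)%N -> sigma j < sigma i,
      U \is unitarymx,
      K *m K ^t* + L *m L ^t* = 1%:M &
      A = U *m block_mx (Sigma *m K) (Sigma *m L) 0 0 *m U ^t*].

(* Main.v *)
Require Import Defs.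
From mathcomp Require Import all_boot all_order all_algebra.
From mathcomp Require Import complex.
From mathcomp Require Import boolp classical_sets reals.

(* Only the rank of Y matters.  Since A Y A = A X A and X A^(k+1) = A^k, Y = 0
   forces A^(k+1) = 0.  If Y has the rank of A, as when Y = A or Y = A^*, then
   rank A <= rank X = rank A^D <= rank A^2, so ind A <= 1; and ind A <= 1 gives
   A X A = A, whence Y = A^+ A X A A^+ = A^+. *)

Import Order.TTheory GRing.Theory Num.Theory.
Local Open Scope ring_scope.
Local Open Scope sesquilinear_scope.

Section WeakDrazin.
Variables (C : numClosedFieldType) (n : nat).
Implicit Types A X Y : 'M[C]_n.

(** With [T] the Drazin inverse, [T A T = T] and [A T = T A] give [T = A T^2], which each induction
    step inserts once. *)
Lemma drazin_expr A j : drazin A = A ^+ j * drazin A ^+ j.+1.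
Proof.
have [dAd Ad _] := drazinP A; elim: j => [|j IHj]; first by rewrite expr0 mul1r.
rewrite {1}IHj [A ^+ j.+1]exprSr [drazin A ^+ j.+1]exprS.
rewrite [drazin A ^+ j.+2]exprS [drazin A ^+ j.+1]exprS -!mulrA; congr (_ * _).
by rewrite !mulrA [A * drazin A]Ad; congr (_ * _); rewrite -[LHS]dAd.
Qed.

Lemma mxrank_drazin_le A j : (\rank (drazin A) <= \rank (A ^+ j))%N.
Proof. by rewrite {1}(drazin_expr A j); exact: mxrankM_maxl. Qed.

Lemma mxind_le1 A : (\rank A <= \rank (A ^+ 2))%N -> (mxind A <= 1)%N.
Proof.
move=> leA; rewrite /mxind; case: ex_minnP => k _; apply.
by rewrite expr1 eqn_leq leA expr2; exact: mxrankM_maxl.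
Qed.

Lemma mxind_gt0 A : A \notin unitmx -> (0 < mxind A)%N.
Proof.
rewrite /mxind; case: ex_minnP => -[|//] /eqP + _.
rewrite expr0 expr1 mxrank1 => rkA /negP[].
by rewrite -row_free_unit /row_free -rkA.
Qed.

(** Iterates [A^2 A^D = A]. It makes [A] a right multiple of any power of [A], so that
    [X A^(k+1) = A^k] applies for whatever [k] comes with [X]. *)
Lemma mxind_le1_expr A j :
  (mxind A <= 1)%N -> A = A ^+ j.+1 * drazin A ^+ j.
Proof.
move=> ind1; have [_ _ Ad] := drazinP A.
have AAd : A * A * drazin A = A.
  (* At index 0 the last Drazin equation reads [A A^D = 1]; at index 1 it is the claim. *)
  case: (mxind A) ind1 Ad => [|[|//]] _ Ad; last exact: Ad.
  by rewrite -mulrA (_ : A * drazin A = 1) ?mulr1 //; exact: Ad.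
elim: j => [|j IHj]; first by rewrite expr1 expr0 mulr1.
rewrite {1}IHj [A ^+ j.+2]exprSr [A ^+ j.+1]exprSr [drazin A ^+ j.+1]exprS.
by rewrite -!mulrA; congr (_ * _); rewrite !mulrA AAd.
Qed.

Lemma weak_cmp_mxind_le1 A X :
    is_minrank_weak_drazin A X -> (mxind A <= 1)%N ->
  mpinv A *m A *m X *m A *m mpinv A = mpinv A.
Proof.
move=> [[k XA] _] ind1; have [_ TAT _ _] := mpinvP A.
have AXA : A *m X *m A = A.
  change (A * X * A = A); rewrite {2}(mxind_le1_expr A k ind1).
  by rewrite mulrA -(mulrA A) [X * _]XA -exprS -mxind_le1_expr.
by rewrite -[in LHS](mulmxA (mpinv A)) -(mulmxA (mpinv A)) AXA.
Qed.

Lemma weak_cmp_mxrank_eq A X (Y := mpinv A *m A *m X *m A *m mpinv A) :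
    is_minrank_weak_drazin A X -> \rank Y = \rank A ->
  Y = mpinv A /\ (mxind A <= 1)%N.
Proof.
move=> hX rkY; suff ind1 : (mxind A <= 1)%N by rewrite /Y weak_cmp_mxind_le1.
apply: mxind_le1; rewrite -rkY; apply: leq_trans (mxrank_drazin_le A 2).
rewrite -hX.2 /Y -2!mulmxA; apply: leq_trans (mxrankM_maxr _ _) _.
exact: mxrankM_maxl.
Qed.

Lemma weak_cmp_eq0 A X :
    is_minrank_weak_drazin A X ->
  mpinv A *m A *m X *m A *m mpinv A = 0 <-> exists k : nat, A ^+ k = 0.
Proof.
move=> [[k XA] rkX]; split=> [Y0|[j Aj0]].
  have [ATA _ _ _] := mpinvP A.
  have AXA : A *m X *m A = 0.
    have : A *m (mpinv A *m A *m X *m A *m mpinv A) *m A = 0.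
      by rewrite Y0 mulmx0 mul0mx.
    by rewrite !mulmxA ATA -(mulmxA _ A (mpinv A)) -(mulmxA _ _ A) ATA.
  (* [A^(k+1) = A (X A^(k+1)) = (A X A) A^k]. *)
  exists k.+1; rewrite exprS -XA exprS.
  by change (A *m (X *m (A *m A ^+ k)) = 0); rewrite !mulmxA AXA mul0mx.
(* The Drazin inverse has rank at most that of [A^j = 0], hence so does [X]. *)
have /eqP : \rank X = 0%N.
  by apply/eqP; rewrite rkX -leqn0 -(mxrank0 C n n) -Aj0 mxrank_drazin_le.
by rewrite mxrank_eq0 => /eqP ->; rewrite mulmx0 !mul0mx.
Qed.

End WeakDrazin.

(* With ind the smallest nonnegative integer k such that
   rank (A^k) = rank (A^(k+1)), an invertible matrix has index 0, so that a
   unitary A satisfies Y = A^* and A^+ = A^* but not ind A = 1.  The third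
   equivalence is therefore stated verbatim for singular A, and with
   ind A <= 1 (equivalent to ind A = 1 when A is singular) for every A. *)
Theorem proposition2p2 (R : realType) (t m : nat) (rs : 'I_t -> nat)
    (sigma : 'I_t -> R)
    (A U : 'M[R[i]]_(\sum_(i < t) rs i + m))
    (K : 'M[R[i]]_(\sum_(i < t) rs i))
    (L : 'M[R[i]]_(\sum_(i < t) rs i, m))
    (X Y : 'M[R[i]]_(\sum_(i < t) rs i + m))
    (hA : hartwig_spindelbock sigma A U K L)
    (hX : is_minrank_weak_drazin A X)
    (hY : Y = mpinv A *m A *m X *m A *m mpinv A) :
  [/\ Y = 0 <-> exists k : nat, A ^+ k = 0,
      Y = A <-> mpinv A = A,
      A \notin unitmx ->
        (Y = A ^t* <-> mpinv A = A ^t* /\ mxind A = 1%N) &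
      Y = A ^t* <-> mpinv A = A ^t* /\ (mxind A <= 1)%N].
Proof.
have rk_adj : \rank (A ^t*) = \rank A by rewrite mxrank_map mxrank_tr.
have YAadj : Y = A ^t* <-> mpinv A = A ^t* /\ (mxind A <= 1)%N.
  rewrite hY; split=> [YA|[<- ind1]]; last exact: weak_cmp_mxind_le1.
  by rewrite -YA; case: (weak_cmp_mxrank_eq _ _ A X hX) => //; rewrite YA.
split=> //; first by rewrite hY; exact: weak_cmp_eq0.
- rewrite hY; split=> [YA|TA].
    by case: (weak_cmp_mxrank_eq _ _ A X hX) => [|<- //]; rewrite YA.
  rewrite weak_cmp_mxind_le1 //; apply: mxind_le1.
  (* Here [A A^+ A = A] becomes [A^3 = A], which bounds the rank of [A] by that of [A^2]. *)
  have [+ _ _ _] := mpinvP A; rewrite TA => AAA.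
  by rewrite -{1}AAA; exact: mxrankM_maxl.
- move=> nuA; rewrite YAadj; split=> [][-> ind1]; split=> //; last by rewrite ind1.
  by apply/eqP; rewrite eqn_leq ind1 mxind_gt0.
Qed.
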